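(* Let $n\ge 2$ be an integer. Every latin $n$-cube of order $5$ has a transversal.
   Context: Let $Q_q=\{0,1,\dots,q-1\}$. A latin $n$-cube of order $q$ is a map $C:Q_q^n\to Q_q$ (an $n$-dimensional array of size $q\times\cdots\times q$ with entries, called symbols, in $Q_q$) such that every line (set of $q$ cells obtained by fixing all coordinates but one) contains all $q$ symbols. A hyperplane is the set of cells obtained by fixing one coordinate at one value. A transversal of a latin $n$-cube of order $q$ is a set of $q$ cells such that every hyperplane contains at most one of these cells and the symbols in these cells are pairwise distinct. *)

(* Defs.v *)
From mathcomp Require Import all_boot.

Set Implicit Arguments.
Unset Strict Implicit.
Unset Printing Implicit Defensive.

Definition cell (n q : nat) := {ffun 'I_n -> 'I_q}.

(* The line through [x] in direction [i]: coordinate [i] is free. *)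
Definition line (n q : nat) (i : 'I_n) (x : cell n q) : {set cell n q} :=
  [set y : cell n q | [forall j : 'I_n, (j != i) ==> (y j == x j)]].

Definition hyperplane (n q : nat) (i : 'I_n) (a : 'I_q) : {set cell n q} :=
  [set x : cell n q | x i == a].

Definition latin_cube (n q : nat) (C : cell n q -> 'I_q) : Prop :=
  forall (i : 'I_n) (x : cell n q) (s : 'I_q),
    exists2 y : cell n q, y \in line i x & C y = s.

Definition cube_transversal (n q : nat) (C : cell n q -> 'I_q)
    (T : {set cell n q}) : Prop :=
  [/\ #|T| = q,
      forall (i : 'I_n) (a : 'I_q), #|T :&: hyperplane i a| <= 1
    & {in T &, injective C}].

(* Main.v *)
Require Import Defs.
From HB Require Import structures.
From mathcomp Require Import all_boot all_algebra.

(** By induction on [n], the hyperplane [x_1 = r] contains five cells [(r, y_k)]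
    that differ in all other coordinates and carry distinct symbols. Let
    [pi_k a] be the symbol at [(a, y_k)]. If the cube has no transversal then,
    for each [j], neither have the five latin squares obtained from the [y_k] by
    freeing the coordinates [1] and [j]. A finite search shows that such squares
    are rigid: for a bijection [phi] of the symbols with Z/5 that depends only on
    the [pi_k], they are [phi (L_k a b) = phi (pi_k a) + kappa b - kappa k].
    Hence all the [y_k] can be translated simultaneously along [j], which adds
    the same constant to all the [phi (pi_k a)] and leaves [phi] valid.
    Translating along all coordinates moves [y_0] onto [y_k], so that
    [phi (pi_k a) = phi (pi_0 a) + t_k] with distinct [t_k]; then the rows [a_k]
    with [phi (pi_0 a_k) = t_k] give symbols [2 t_k], i.e. a transversal. *)

Set Implicit Arguments.
Unset Strict Implicit.
Unset Printing Implicit Defensive.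

(** * Five-element indices and vectors *)

(* A copy of Z/5 on which the search below can be evaluated quickly. *)
Inductive five := f0 | f1 | f2 | f3 | f4.

Definition eq5 (x y : five) : bool :=
  match x, y with
  | f0, f0 | f1, f1 | f2, f2 | f3, f3 | f4, f4 => true
  | _, _ => false
  end.

Lemma eq5P : Equality.axiom eq5. Proof. by case; case; constructor. Qed.
HB.instance Definition _ := hasDecEq.Build five eq5P.

Definition fives : seq five := [:: f0; f1; f2; f3; f4].

Definition ord_of_five (x : five) : 'I_5 :=
  match x with
  | f0 => @Ordinal 5 0 isT | f1 => @Ordinal 5 1 isT | f2 => @Ordinal 5 2 isT
  | f3 => @Ordinal 5 3 isT | f4 => @Ordinal 5 4 isT
  end.

Definition five_of_ord (i : 'I_5) : five := nth f0 fives i.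

Lemma ord_of_fiveK : cancel ord_of_five five_of_ord. Proof. by case. Qed.

Lemma five_of_ordK : cancel five_of_ord ord_of_five.
Proof. by move=> [[|[|[|[|[|i]]]]] Hi] //; apply: val_inj. Qed.

HB.instance Definition _ := CanIsCountable ord_of_fiveK.

Lemma fives_enumP : Finite.axiom fives. Proof. by case. Qed.
HB.instance Definition _ := isFinite.Build five fives_enumP.

Lemma mem_fives x : x \in fives. Proof. by case: x. Qed.

Definition succ5 (x : five) : five :=
  match x with f0 => f1 | f1 => f2 | f2 => f3 | f3 => f4 | f4 => f0 end.

Definition add5 (x y : five) : five :=
  match x with
  | f0 => y | f1 => succ5 y | f2 => succ5 (succ5 y)
  | f3 => succ5 (succ5 (succ5 y)) | f4 => succ5 (succ5 (succ5 (succ5 y)))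
  end.

Definition opp5 (x : five) : five :=
  match x with f0 => f0 | f1 => f4 | f2 => f3 | f3 => f2 | f4 => f1 end.

Lemma add5A : associative add5. Proof. by case; case; case. Qed.
Lemma add5C : commutative add5. Proof. by case; case. Qed.
Lemma add05 : left_id f0 add5. Proof. by []. Qed.
Lemma addN5 : left_inverse f0 opp5 add5. Proof. by case. Qed.
HB.instance Definition _ := GRing.isZmodule.Build five add5A add5C add05 addN5.

Lemma double5_inj : injective (fun x : five => (x + x)%R).
Proof. by case; case. Qed.

Lemma inj5_bij (f : five -> five) : injective f -> exists2 g, cancel f g & cancel g f.
Proof. by move=> /injF_bij[g fK gK]; exists g. Qed.

(** Explicit five-tuples, not finite functions, keep evaluation in the kernel fast. Under call by
    value, [tab] also tabulates a function once and for all. *)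
Inductive vec (A : Type) := V5 of A & A & A & A & A.

Definition vec_tuple A (v : vec A) :=
  let: V5 a b c d e := v in (a, b, c, d, e).
Definition tuple_vec A (t : A * A * A * A * A) :=
  let: (a, b, c, d, e) := t in V5 a b c d e.
Lemma vec_tupleK A : cancel (@vec_tuple A) (@tuple_vec A). Proof. by case. Qed.
HB.instance Definition _ (A : eqType) := Equality.copy (vec A) (can_type (@vec_tupleK A)).

Definition get A (v : vec A) (i : five) : A :=
  let: V5 a b c d e := v in
  match i with f0 => a | f1 => b | f2 => c | f3 => d | f4 => e end.

Definition put A (v : vec A) (i : five) (y : A) : vec A :=
  let: V5 a b c d e := v in
  match i with
  | f0 => V5 y b c d e | f1 => V5 a y c d e | f2 => V5 a b y d e
  | f3 => V5 a b c y e | f4 => V5 a b c d y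
  end.

Definition tab A (f : five -> A) : vec A := V5 (f f0) (f f1) (f f2) (f f3) (f f4).

Lemma get_tab A (f : five -> A) i : get (tab f) i = f i. Proof. by case: i. Qed.

Lemma get_put A (v : vec A) i y j : get (put v i y) j = if j == i then y else get v j.
Proof. by case: v => a b c d e; case: i; case: j. Qed.

Lemma vec_ext A (v w : vec A) : get v =1 get w -> v = w.
Proof.
case: v w => [a b c d e] [a' b' c' d' e'] vw.
by rewrite [a](vw f0) [b](vw f1) [c](vw f2) [d](vw f3) [e](vw f4).
Qed.

Definition set5 := vec bool.
Definition perm5 := vec five.
Definition full5 : set5 := tab (fun=> true).
Definition idp : perm5 := tab id.
Definition rem5 (S : set5) (i : five) : set5 := put S i false.

Lemma get_rem5 S i j : get (rem5 S i) j = (j != i) && get S j.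
Proof. by rewrite get_put; case: (j == i). Qed.

(** The last candidate is taken untested, so this inverts only injective [p]. Conversely,
    [inv5 p (get p x) = x] for all [x] is a computable test of injectivity. *)
Definition inv5 (p : perm5) (y : five) : five :=
  if eq5 (get p f0) y then f0 else if eq5 (get p f1) y then f1 else
  if eq5 (get p f2) y then f2 else if eq5 (get p f3) y then f3 else f4.

Lemma inv5K p : injective (get p) -> cancel (get p) (inv5 p).
Proof.
by move=> pI x; rewrite /inv5 -![eq5]/(@eq_op five) !(inj_eq pI); case: x.
Qed.

Lemma inv5Kr p : injective (get p) -> cancel (inv5 p) (get p).
Proof.
move=> pI; have [g pK gK] := inj5_bij pI.
by move=> y; rewrite -{1}(gK y) inv5K.
Qed.

(* The conditional form stops at the first hit under call by value too. *)
Fixpoint some_in T (f : T -> bool) (s : seq T) : bool :=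
  if s is x :: s' then if f x then true else some_in f s' else false.

Lemma some_inE T (f : T -> bool) s : some_in f s = has f s.
Proof. by elim: s => //= x s ->; case: (f x). Qed.

Arguments some_in : simpl never.

(** * Five latin squares without a transversal *)

Definition latin5 (L : five -> five -> five -> five) : Prop :=
  (forall k a, injective (L k a)) /\ (forall k b, injective (L k ^~ b)).

(** Here [k] is the square, [a] the row and [b] the column of [L k a b]. The transversals meant take
    one cell from each of the five squares, not five cells from one. *)
Definition no_transversal (L : five -> five -> five -> five) : Prop :=
  forall alpha beta : five -> five, injective alpha -> injective beta ->
    ~ injective (fun k => L k (alpha k) (beta k)).

(* State of the search: for each layer, the columns already known. *)
Definition state := vec (seq (five * perm5)).

Definition consistent (L : five -> five -> five -> five) (st : state) : Prop :=
  forall k c p, (c, p) \in get st k -> forall a, get p a = L k a c.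

(* Is there a partial transversal through the known columns of the layers
   [ks], using only rows in [R], columns in [C] and symbols in [S]? *)
Fixpoint search (st : state) (ks : seq five) (R C S : set5) : bool :=
  if ks is k :: ks' then
    some_in (fun cp : five * perm5 => if get C cp.1 then
      let C' := rem5 C cp.1 in
      some_in (fun r => if get R r then
        let y := get cp.2 r in
        if get S y then search st ks' (rem5 R r) C' (rem5 S y)
        else false else false) fives
      else false) (get st k)
  else true.

(** Adds one cell to a partial transversal. The new value was removed from the allowed set before
    the others were chosen, so it differs from them. Rows, columns and symbols are all handled this
    way. *)
Lemma extend_inj (ks : seq five) k (f : five -> five) (S : set5) y :
    k \notin ks -> get S y -> {in ks, forall x, get (rem5 S y) (f x)} ->
    {in ks &, injective f} ->
  let g x := if x == k then y else f x in
  {in k :: ks, forall x, get S (g x)} /\ {in k :: ks &, injective g}.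
Proof.
move=> kks Sy fS fI g; have fy x : x \in ks -> f x != y.
  by move=> /fS; rewrite get_rem5 => /andP[].
have gk x : x \in ks -> g x = f x.
  by rewrite /g; case: eqP => // -> ; rewrite (negPf kks).
split=> [x | x x']; rewrite !inE.
  case/predU1P => [-> | xs]; first by rewrite /g eqxx.
  by rewrite gk //; move: (fS _ xs); rewrite get_rem5 => /andP[].
case/predU1P => [-> | xs]; case/predU1P => [-> | x's] //.
- by rewrite (gk _ x's) /g eqxx => e; move: (fy _ x's); rewrite -e eqxx.
- by rewrite (gk _ xs) /g eqxx => e; move: (fy _ xs); rewrite e eqxx.
- by rewrite !gk //; apply: fI.
Qed.

Lemma search_sound L st ks R C S : consistent L st -> uniq ks ->
    search st ks R C S -> exists alpha beta : five -> five,
  [/\ {in ks, forall k, get R (alpha k)}, {in ks, forall k, get C (beta k)} &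
      {in ks, forall k, get S (L k (alpha k) (beta k))}] /\
  [/\ {in ks &, injective alpha}, {in ks &, injective beta} &
      {in ks &, injective (fun k => L k (alpha k) (beta k))}].
Proof.
move=> Lst; elim: ks R C S => [|k ks IH] R C S /=; first by move=> _ _; exists id, id.
move=> /andP[kks /IH{}IH]; rewrite some_inE => /hasP[[c p] cp] /=.
case: ifP => // Cc; rewrite some_inE => /hasP[r _]; case: ifP => // Rr.
case: ifP => // Sy /IH[alpha [beta [[aR bC sS] [aI bI sI]]]].
have [aR' aI'] := extend_inj kks Rr aR aI.
have [bC' bI'] := extend_inj kks Cc bC bI.
have [sS' sI'] := extend_inj kks Sy sS sI.
exists (fun x => if x == k then r else alpha x), (fun x => if x == k then c else beta x).
have E x : L x (if x == k then r else alpha x) (if x == k then c else beta x)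
    = if x == k then get p r else L x (alpha x) (beta x).
  by case: eqP => // ->; rewrite (Lst _ _ _ cp).
split; split=> //.
- by move=> x /sS'; rewrite E.
- by move=> x x' xs x's /=; rewrite !E; apply: sI'.
Qed.

(** * Enumeration of the possible columns *)

Definition fits (st : state) (ks : seq five) (k c i s : five) : bool :=
  if all (fun cp => eq5 cp.1 c || ~~ eq5 (get cp.2 i) s) (get st k)
  then ~~ search st ks (rem5 full5 i) (rem5 full5 c) (rem5 full5 s)
  else false.

(** A partial transversal found in the other layers avoids row [i], column [c] and the symbol there,
    so adding this cell would give a transversal of [L]. *)
Lemma fits_sound L st ks k c i : latin5 L -> no_transversal L -> consistent L st ->
  perm_eq (k :: ks) fives -> fits st ks k c i (L k i c).
Proof.
move=> [rowI _] Lbad Lst kks; have := perm_uniq kks; rewrite /= => /andP[k_ks ksU].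
have allk x : x \in k :: ks by rewrite (perm_mem kks) mem_fives.
rewrite /fits ifT; last first.
  apply/allP=> [[c' p] cp]; rewrite /= (Lst _ _ _ cp) -![eq5]/(@eq_op five).
  by rewrite (inj_eq (@rowI k i)) orbN.
apply/negP => /(search_sound Lst ksU)[alpha [beta [[aR bC sS] [aI bI sI]]]].
have full x : get full5 x by case: x.
have [_ aI'] := extend_inj k_ks (full i) aR aI.
have [_ bI'] := extend_inj k_ks (full c) bC bI.
have [_ sI'] := extend_inj k_ks (full _) sS sI.
apply: (Lbad (fun x => if x == k then i else alpha x) (fun x => if x == k then c else beta x)).
- by move=> x y; apply: aI'.
- by move=> x y; apply: bI'.
- move=> x y xy; apply: sI' => //; move: xy.
  by case: (x =P k) => [->|_]; case: (y =P k) => [->|_].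
Qed.

Definition elems (S : set5) : seq five := [seq x <- fives | get S x].

Lemma mem_elems S x : (x \in elems S) = get S x.
Proof. by rewrite mem_filter mem_fives andbT. Qed.

(* Injective [p] with [f i (p i)] for all [i]; the tests for emptiness avoid
   evaluating [f] on the later rows when an earlier one is empty. *)
Definition perms_in (f : five -> five -> bool) : seq perm5 :=
  let A0 := tab (f f0) in if elems A0 is [::] then [::] else
  let A1 := tab (f f1) in if elems A1 is [::] then [::] else
  let A2 := tab (f f2) in if elems A2 is [::] then [::] else
  let A3 := tab (f f3) in if elems A3 is [::] then [::] else
  let A4 := tab (f f4) in
  flatten [seq
    flatten [seq
      flatten [seq
        flatten [seq
          [seq V5 a b c d e | e <- elems (rem5 (rem5 (rem5 (rem5 A4 a) b) c) d)]
        | d <- elems (rem5 (rem5 (rem5 A3 a) b) c)]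
      | c <- elems (rem5 (rem5 A2 a) b)]
    | b <- elems (rem5 A1 a)]
  | a <- elems A0].

Lemma mem_perms_in (f : five -> five -> bool) p : injective (get p) -> (forall i, f i (get p i)) ->
  p \in perms_in f.
Proof.
case: p => a b c d e pI fp; set p := V5 a b c d e in pI fp.
have ne i j : i != j -> get p i != get p j by rewrite (inj_eq pI).
(* No row is empty, so none of the early exits of [perms_in] is taken. *)
have el i : exists y s, elems (tab (f i)) = y :: s.
  have : get p i \in elems (tab (f i)) by rewrite mem_elems get_tab fp.
  by case: (elems _) => // y s; exists y, s.
have [y0 [s0 e0]] := el f0; have [y1 [s1 e1]] := el f1.
have [y2 [s2 e2]] := el f2; have [y3 [s3 e3]] := el f3.
rewrite /perms_in {1}e0 {1}e1 {1}e2 {1}e3.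
apply/flatten_mapP; exists a; first by rewrite mem_elems get_tab (fp f0).
apply/flatten_mapP; exists b.
  by rewrite mem_elems get_rem5 get_tab (fp f1) (ne f1 f0).
apply/flatten_mapP; exists c.
  by rewrite mem_elems !get_rem5 get_tab (fp f2) (ne f2 f0) ?(ne f2 f1).
apply/flatten_mapP; exists d.
  by rewrite mem_elems !get_rem5 get_tab (fp f3) (ne f3 f0) ?(ne f3 f1) ?(ne f3 f2).
apply: map_f; rewrite mem_elems !get_rem5 get_tab (fp f4).
by rewrite (ne f4 f0) ?(ne f4 f1) ?(ne f4 f2) ?(ne f4 f3).
Qed.

(* Layers with few usable columns come first, so that [search] fails early. *)
Definition others (st : state) (k c : five) : seq five :=
  let len := tab (fun j => size [seq cp <- get st j | ~~ eq5 cp.1 c]) in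
  sort (fun i j => get len i <= get len j) [seq j <- fives | ~~ eq5 j k].

Definition cands (st : state) (k c : five) : seq perm5 :=
  let ks := others st k c in perms_in (fits st ks k c).

Lemma perm_others st k c : perm_eq (k :: others st k c) fives.
Proof.
rewrite (perm_trans (y := k :: [seq j <- fives | ~~ eq5 j k])) //.
  by rewrite perm_cons perm_sort.
by case: k.
Qed.

Lemma cands_sound L st k c : latin5 L -> no_transversal L -> consistent L st ->
  tab (L k ^~ c) \in cands st k c.
Proof.
move=> Ll Lbad Lst; apply: mem_perms_in => [a b | i]; rewrite !get_tab.
  exact: Ll.2.
exact: fits_sound (perm_others _ _ _).
Qed.

Fixpoint run (cells : seq (five * five)) (sts : seq state) : seq state :=
  if cells is (k, c) :: cells' then
    run cells' (flatten [seq
      [seq put st k ((c, p) :: get st k) | p <- cands st k c] | st <- sts])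
  else sts.

(** The true column of [L] is always among the candidates, so some branch keeps agreeing with [L].
    In particular, no [L] exists when all branches die out. *)
Lemma run_sound L cells sts st : latin5 L -> no_transversal L ->
  st \in sts -> consistent L st -> exists2 st', st' \in run cells sts & consistent L st'.
Proof.
move=> Ll Lbad; elim: cells sts st => [|[k c] cells IH] sts st; first by exists st.
move=> stin Lst; apply: (IH _ (put st k ((c, tab (L k ^~ c)) :: get st k))).
  by apply/flatten_mapP; exists st => //; apply: map_f; apply: cands_sound.
move=> k' c' p; rewrite get_put; case: eqP => [-> | _]; last exact: Lst.
rewrite inE => /predU1P[[-> ->] a | /Lst //]; exact: get_tab.
Qed.

(** * Rigidity and its certificates *)

(* [phi] turns the symbols into Z/5 in such a way that, in every family [L] of
   latin squares without transversal in which column [k] of layer [k] is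
   [pi k], any two columns of a layer differ by a translation, and the
   translations are the same in all layers. *)
Definition rigid (phi : five -> five) (pi : five -> five -> five) : Prop :=
  forall L, latin5 L -> no_transversal L -> (forall k a, L k a k = pi k a) ->
  exists kappa : five -> five, forall k a b,
    phi (L k a b) = (phi (pi k a) + (kappa b - kappa k))%R.

Definition rigid_columns (pi : five -> five -> five) : Prop :=
  exists2 phi, injective phi & rigid phi pi.

Fixpoint lookup (c : five) (l : seq (five * perm5)) : option perm5 :=
  if l is (c', p) :: l' then if eq5 c' c then Some p else lookup c l' else None.

Lemma lookup_mem c l p : lookup c l = Some p -> (c, p) \in l.
Proof.
elim: l => //= [[c' q] l IH]; case: eq5P => [-> [->] | _ /IH cl].
  by rewrite mem_head.
by rewrite inE cl orbT.
Qed.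

(** Only differences of [kappa] matter, so it can be read off in row [f0] of layer [f0], relative to
    column [f0]. The default is harmless: [translated] rejects states with a missing column. *)
Definition shift (phi : perm5) (pi : vec perm5) (st : state) (c : five) : five :=
  if lookup c (get st f0) is Some p
  then add5 (get phi (get p f0)) (opp5 (get phi (get (get pi f0) f0))) else f0.

Definition translated (phi : perm5) (pi : vec perm5) (st : state) : bool :=
  let kappa := shift phi pi st in
  all (fun k => all (fun c => if lookup c (get st k) is Some p then
    all (fun a => eq5 (get phi (get p a))
      (add5 (get phi (get (get pi k) a)) (add5 (kappa c) (opp5 (kappa k))))) fives
    else false) fives) fives.

Definition diagonal (pi : vec perm5) : state := tab (fun k => [:: (k, get pi k)]).

Definition certificate : Type := vec perm5 * perm5 * seq (five * five).

Definition valid_certificate (r : certificate) : bool :=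
  let: (pi, phi, cells) := r in
  all (fun x => eq5 (inv5 phi (get phi x)) x) fives &&
  all (translated phi pi) (run cells [:: diagonal pi]).

Lemma valid_certificateP pi phi cells : valid_certificate (pi, phi, cells) ->
  rigid_columns (fun k => get (get pi k)).
Proof.
move=> /andP[/allP phiK /allP leaves]; exists (get phi).
  by apply: (can_inj (g := inv5 phi)) => x; apply/eqP/phiK/mem_fives.
move=> L Ll Lbad Lpi.
have Ldiag : consistent L (diagonal pi).
  by move=> k c p; rewrite get_tab inE => /eqP[-> ->] a.
have [st stin Lst] := run_sound cells Ll Lbad (mem_head _ [::]) Ldiag.
have /allP tr := leaves _ stin; exists (shift phi pi st) => k a b.
have /allP/(_ b (mem_fives b)) := tr k (mem_fives k).
case Eb: (lookup b (get st k)) => [p|//] /allP/(_ a (mem_fives a))/eq5P.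
by rewrite (Lst _ _ _ (lookup_mem Eb)).
Qed.

(** * Relabelling and normal forms *)

(** Permuting layers, rows and symbols preserves transversals. The columns are permuted by the same
    [sigma] as the layers, so that column [k] of layer [k] stays on the diagonal. *)
Lemma rigid_columns_relabel pi (sigma rho psi : five -> five) :
    injective sigma -> injective rho -> injective psi ->
  rigid_columns (fun k x => psi (pi (sigma k) (rho x))) -> rigid_columns pi.
Proof.
move=> sI rI psiI [phi phiI phiR]; exists (phi \o psi); first exact: inj_comp.
have [si sK siK] := inj5_bij sI; have [ri rK riK] := inj5_bij rI.
move=> L [Lrow Lcol] Lbad Lpi.
have [||k x|kappa kappaE] := phiR (fun k x l => psi (L (sigma k) (rho x) (sigma l))).
- split=> [k a | k b] x y /psiI; first by move=> /Lrow/sI.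
  by move=> /Lcol/rI.
- move=> alpha beta aI bI sbI.
  apply: (Lbad (fun k => rho (alpha (si k))) (fun k => sigma (beta (si k)))).
  + by move=> x y /rI/aI/(can_inj siK).
  + by move=> x y /sI/bI/(can_inj siK).
  + move=> x y xy; apply: (can_inj siK); apply: sbI; rewrite !siK.
    by congr psi.
- by rewrite Lpi.
exists (kappa \o si) => k a b /=.
by have := kappaE (si k) (ri a) (si b); rewrite !siK riK.
Qed.

(** The relabelling [g], which is translation by [- t] when read through [phi], turns a family with
    diagonal [pi'] into one with diagonal [pi]; the translation then cancels. This keeps one [phi]
    valid through successive moves. *)
Lemma rigid_shift (phi : five -> five) pi pi' t : injective phi -> rigid phi pi ->
  (forall k a, phi (pi' k a) = phi (pi k a) + t)%R -> rigid phi pi'.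
Proof.
move=> phiI phiR pi'E L [Lrow Lcol] Lbad Lpi; have [psi phiK psiK] := inj5_bij phiI.
pose g s := psi (phi s - t)%R; have gI : injective g.
  by move=> x y /(can_inj psiK)/GRing.addIr/phiI.
have [||k a|kappa kE] := phiR (fun k a b => g (L k a b)).
- by split=> [k a|k b] x y /gI; [apply: Lrow | apply: Lcol].
- by move=> alpha beta aI bI sI; apply: (Lbad _ _ aI bI) => k l e; apply: sI; rewrite /= e.
- by rewrite Lpi /g pi'E GRing.addrK phiK.
exists kappa => k a b; have := kE k a b; rewrite psiK pi'E => /(congr1 (+%R^~ t)).
by rewrite GRing.subrK GRing.addrAC.
Qed.

(** After reordering by [sg], [psi] renames the symbols so that row [r] reads 0, ..., 4. Then [rho]
    reorders the rows so that the first column is the identity, which puts row [r] first. *)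
Definition normalize (sg : perm5) (r : five) (N : vec perm5) : vec perm5 :=
  let psi := tab (inv5 (tab (fun k => get (get N (get sg k)) r))) in
  let rho := tab (inv5 (tab (fun x => get psi (get (get N (get sg f0)) x)))) in
  tab (fun k => let p := get N (get sg k) in tab (fun x => get psi (get p (get rho x)))).

Section Normalize.
Variables (sg : perm5) (r : five) (N : vec perm5).
Hypotheses (sgI : injective (get sg)) (NI : forall k, injective (get (get N k))).
Hypothesis rowI : injective (fun k => get (get N k) r).

Let row := tab (fun k => get (get N (get sg k)) r).
Let psi := tab (inv5 row).
Let col := tab (fun x => get psi (get (get N (get sg f0)) x)).
Let rho := tab (inv5 col).

Let rowI' : injective (get row).
Proof. by move=> k l; rewrite !get_tab => /rowI/sgI. Qed.

Let psiI : injective (get psi).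
Proof. by move=> x y; rewrite !get_tab => /(can_inj (inv5Kr rowI')). Qed.

Let colI : injective (get col).
Proof. by move=> x y; rewrite [get col x]get_tab [get col y]get_tab => /psiI/NI. Qed.

Let rhoI : injective (get rho).
Proof. by move=> x y; rewrite !get_tab => /(can_inj (inv5Kr colI)). Qed.

Let normalizeE k x :
  get (get (normalize sg r N) k) x = get psi (get (get N (get sg k)) (get rho x)).
Proof. by rewrite [in LHS]/normalize get_tab [in LHS]get_tab. Qed.

Lemma normalize_inj k : injective (get (get (normalize sg r N) k)).
Proof. by move=> x y; rewrite !normalizeE => /psiI/NI/rhoI. Qed.

Lemma normalize_id : get (normalize sg r N) f0 = idp.
Proof.
apply: vec_ext => x; rewrite normalizeE.
have := inv5Kr colI x; rewrite -[inv5 col x]get_tab [get col _]get_tab => ->.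
by case: x.
Qed.

Lemma normalize_row k : get (get (normalize sg r N) k) f0 = k.
Proof.
have psi_row l : get psi (get (get N (get sg l)) r) = l.
  by rewrite get_tab -[get (get N _) r](get_tab (fun k => get (get N (get sg k)) r)) inv5K.
rewrite normalizeE; suff -> : get rho f0 = r by apply: psi_row.
by apply: colI; rewrite [get rho _]get_tab inv5Kr // [RHS]get_tab psi_row.
Qed.

Lemma rigid_normalize :
  rigid_columns (fun k => get (get (normalize sg r N) k)) ->
  rigid_columns (fun k => get (get N k)).
Proof.
move=> [phi phiI phiR]; apply: (rigid_columns_relabel sgI rhoI psiI).
exists phi => // L Ll Lbad Lpi; have [k a|kappa kappaE] := phiR L Ll Lbad _.
  by rewrite Lpi normalizeE.
by exists kappa => k a b; rewrite kappaE normalizeE.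
Qed.
End Normalize.

(** * The finite case analysis *)

(* Five columns with [pi_k f0 = k] and [pi_0 = id] but without transversal, one
   family for each orbit of the permutations of the layers, with the labelling
   [phi] (which is irrelevant when no family of squares survives the search) and
   the order in which the other columns are guessed, given as (layer, column). *)
Definition start_table : seq certificate := [::
  (V5 idp (V5 f1 f0 f2 f3 f4) (V5 f2 f0 f3 f1 f4) (V5 f3 f4 f1 f2 f0) (V5 f4
      f3 f0 f2 f1), idp,
   [:: (f0, f3); (f3, f0); (f3, f4); (f4, f3); (f4, f0); (f0, f4); (f0, f2);
       (f2, f0)]);
  (V5 idp (V5 f1 f0 f2 f3 f4) (V5 f2 f0 f3 f1 f4) (V5 f3 f4 f1 f2 f0) (V5 f4
      f3 f1 f2 f0), idp,
   [:: (f3, f4); (f4, f3); (f0, f1); (f1, f0); (f1, f3); (f4, f1); (f1, f4);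
       (f0, f4)]);
  (V5 idp (V5 f1 f0 f2 f3 f4) (V5 f2 f0 f3 f4 f1) (V5 f3 f2 f4 f1 f0) (V5 f4
      f0 f1 f2 f3), idp,
   [:: (f1, f2); (f2, f1); (f2, f3); (f3, f1); (f3, f2); (f1, f3); (f2, f4);
       (f4, f3); (f1, f4); (f4, f2); (f4, f1); (f3, f4); (f0, f4); (f1,
       f0)]);
  (V5 idp (V5 f1 f0 f2 f3 f4) (V5 f2 f0 f3 f4 f1) (V5 f3 f2 f4 f1 f0) (V5 f4
      f1 f0 f2 f3), (V5 f0 f1 f4 f3 f2),
   [:: (f0, f2); (f2, f0); (f2, f3); (f3, f2); (f3, f0); (f0, f3); (f3, f4);
       (f4, f0); (f2, f4); (f0, f4); (f4, f2); (f4, f3); (f0, f1); (f1, f2);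
       (f2, f1); (f3, f1); (f4, f1); (f1, f0); (f1, f3); (f1, f4)]);
  (V5 idp (V5 f1 f0 f2 f3 f4) (V5 f2 f0 f3 f4 f1) (V5 f3 f4 f0 f1 f2) (V5 f4
      f3 f1 f0 f2), idp,
   [:: (f1, f4); (f4, f1); (f0, f4); (f1, f0); (f0, f1); (f4, f0); (f1, f2);
       (f2, f0); (f0, f2); (f2, f1)]);
  (V5 idp (V5 f1 f0 f2 f3 f4) (V5 f2 f0 f3 f4 f1) (V5 f3 f4 f1 f0 f2) (V5 f4
      f3 f1 f0 f2), (V5 f0 f1 f4 f3 f2),
   [:: (f0, f4); (f4, f0); (f0, f3); (f3, f4); (f3, f0); (f4, f3); (f0, f1);
       (f1, f0); (f4, f1); (f3, f1); (f0, f2); (f1, f4); (f1, f3); (f2, f1);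
       (f3, f2); (f4, f2); (f1, f2); (f2, f0); (f2, f3); (f2, f4)]);
  (V5 idp (V5 f1 f0 f2 f3 f4) (V5 f2 f0 f3 f4 f1) (V5 f3 f4 f1 f2 f0) (V5 f4
      f2 f1 f0 f3), idp,
   [:: (f0, f1); (f1, f0); (f1, f2); (f2, f1); (f0, f2); (f2, f0); (f1, f3);
       (f3, f0); (f0, f3); (f2, f3)]);
  (V5 idp (V5 f1 f0 f2 f3 f4) (V5 f2 f3 f0 f1 f4) (V5 f3 f4 f2 f0 f1) (V5 f4
      f2 f0 f3 f1), idp,
   [:: (f0, f1); (f1, f0); (f2, f4); (f4, f2); (f3, f4); (f4, f3)]);
  (V5 idp (V5 f1 f0 f2 f3 f4) (V5 f2 f3 f0 f1 f4) (V5 f3 f4 f2 f0 f1) (V5 f4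
      f2 f1 f3 f0), idp,
   [:: (f0, f1); (f1, f0)]);
  (V5 idp (V5 f1 f0 f2 f3 f4) (V5 f2 f3 f0 f4 f1) (V5 f3 f2 f1 f4 f0) (V5 f4
      f2 f0 f1 f3), idp,
   [:: (f0, f1); (f1, f0); (f0, f2); (f2, f1); (f2, f0); (f0, f3); (f3, f2);
       (f1, f3)]);
  (V5 idp (V5 f1 f0 f2 f3 f4) (V5 f2 f3 f0 f4 f1) (V5 f3 f2 f1 f4 f0) (V5 f4
      f2 f1 f0 f3), idp,
   [:: (f0, f1); (f1, f0); (f0, f2); (f2, f0); (f2, f1); (f0, f4); (f4, f2);
       (f2, f4); (f0, f3); (f3, f1); (f2, f3); (f3, f2)]);
  (V5 idp (V5 f1 f0 f2 f4 f3) (V5 f2 f0 f3 f1 f4) (V5 f3 f1 f0 f4 f2) (V5 f4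
      f3 f1 f2 f0), idp,
   [:: (f0, f4); (f4, f0); (f1, f4); (f4, f1); (f0, f1); (f1, f0)]);
  (V5 idp (V5 f1 f0 f2 f4 f3) (V5 f2 f0 f3 f1 f4) (V5 f3 f1 f2 f4 f0) (V5 f4
      f3 f1 f2 f0), idp,
   [:: (f1, f4); (f4, f1); (f1, f2); (f2, f4); (f4, f2); (f2, f1); (f1, f3);
       (f3, f1)]);
  (V5 idp (V5 f1 f0 f2 f4 f3) (V5 f2 f0 f3 f1 f4) (V5 f3 f1 f4 f2 f0) (V5 f4
      f1 f0 f2 f3), idp,
   [:: (f1, f2); (f2, f1); (f0, f3); (f3, f0); (f3, f4); (f4, f3)]);
  (V5 idp (V5 f1 f0 f2 f4 f3) (V5 f2 f0 f3 f1 f4) (V5 f3 f1 f4 f2 f0) (V5 f4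
      f3 f1 f2 f0), idp,
   [:: (f1, f4); (f4, f1); (f1, f2); (f2, f4); (f2, f1); (f4, f2)]);
  (V5 idp (V5 f1 f0 f2 f4 f3) (V5 f2 f0 f3 f1 f4) (V5 f3 f2 f1 f0 f4) (V5 f4
      f1 f3 f2 f0), (V5 f0 f1 f3 f4 f2),
   [:: (f0, f3); (f3, f0); (f0, f1); (f1, f0); (f1, f3); (f3, f1); (f3, f4);
       (f4, f1); (f0, f4); (f4, f3); (f1, f4); (f3, f2); (f4, f0); (f2, f1);
       (f1, f2); (f2, f4); (f2, f0); (f2, f3); (f4, f2); (f0, f2)]);
  (V5 idp (V5 f1 f0 f2 f4 f3) (V5 f2 f0 f3 f1 f4) (V5 f3 f2 f1 f4 f0) (V5 f4
      f3 f1 f2 f0), idp,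
   [:: (f0, f4); (f4, f0); (f0, f2); (f2, f4); (f2, f0); (f4, f2)]);
  (V5 idp (V5 f1 f0 f2 f4 f3) (V5 f2 f0 f3 f4 f1) (V5 f3 f2 f1 f0 f4) (V5 f4
      f1 f0 f2 f3), idp,
   [:: (f0, f3); (f3, f0); (f0, f2); (f2, f3); (f2, f0); (f3, f2); (f0, f4);
       (f4, f2); (f2, f4)]);
  (V5 idp (V5 f1 f0 f2 f4 f3) (V5 f2 f0 f3 f4 f1) (V5 f3 f4 f1 f2 f0) (V5 f4
      f1 f0 f2 f3), idp,
   [:: (f1, f2); (f2, f1); (f2, f3); (f3, f2); (f1, f3); (f3, f1)]);
  (V5 idp (V5 f1 f0 f2 f4 f3) (V5 f2 f0 f3 f4 f1) (V5 f3 f4 f1 f2 f0) (V5 f4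
      f1 f2 f0 f3), (V5 f0 f1 f3 f2 f4),
   [:: (f2, f3); (f3, f2); (f3, f4); (f4, f3); (f2, f4); (f2, f1); (f4, f2);
       (f1, f3); (f1, f2); (f1, f4); (f1, f0); (f4, f1); (f3, f0); (f3, f1);
       (f0, f3); (f0, f4); (f0, f1); (f0, f2); (f4, f0); (f2, f0)]);
  (V5 idp (V5 f1 f0 f2 f4 f3) (V5 f2 f3 f0 f1 f4) (V5 f3 f1 f4 f0 f2) (V5 f4
      f1 f3 f2 f0), idp,
   [:: (f0, f3); (f3, f0); (f3, f4); (f4, f3); (f0, f4); (f4, f0)]);
  (V5 idp (V5 f1 f0 f2 f4 f3) (V5 f2 f3 f0 f1 f4) (V5 f3 f2 f4 f0 f1) (V5 f4
      f1 f3 f2 f0), idp,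
   [:: (f0, f3); (f3, f0); (f0, f2); (f2, f0); (f3, f2); (f2, f3); (f3, f4);
       (f4, f2); (f0, f4)]);
  (V5 idp (V5 f1 f0 f2 f4 f3) (V5 f2 f3 f0 f1 f4) (V5 f3 f4 f1 f0 f2) (V5 f4
      f1 f3 f2 f0), idp,
   [:: (f0, f3); (f3, f0); (f2, f3); (f3, f2); (f0, f2); (f2, f0); (f0, f1);
       (f1, f0); (f2, f1)]);
  (V5 idp (V5 f1 f0 f2 f4 f3) (V5 f2 f3 f0 f4 f1) (V5 f3 f2 f1 f0 f4) (V5 f4
      f1 f0 f2 f3), idp,
   [:: (f0, f3); (f3, f0); (f0, f2); (f2, f3); (f3, f2); (f2, f0); (f3, f4);
       (f4, f0)]);
  (V5 idp (V5 f1 f0 f2 f4 f3) (V5 f2 f3 f0 f4 f1) (V5 f3 f2 f1 f4 f0) (V5 f4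
      f1 f2 f0 f3), idp,
   [:: (f1, f3); (f3, f1); (f3, f4); (f4, f3); (f1, f4); (f4, f1); (f1, f2);
       (f2, f1)]);
  (V5 idp (V5 f1 f0 f2 f4 f3) (V5 f2 f3 f0 f4 f1) (V5 f3 f2 f4 f1 f0) (V5 f4
      f1 f0 f2 f3), idp,
   [:: (f2, f3); (f3, f2); (f0, f4); (f4, f0); (f1, f3); (f3, f1); (f1, f2);
       (f2, f1)]);
  (V5 idp (V5 f1 f0 f2 f4 f3) (V5 f2 f3 f4 f0 f1) (V5 f3 f4 f0 f2 f1) (V5 f4
      f2 f3 f0 f1), idp,
   [:: (f0, f1); (f1, f0); (f0, f2); (f2, f1); (f1, f2); (f2, f0)]);
  (V5 idp (V5 f1 f0 f2 f4 f3) (V5 f2 f3 f4 f0 f1) (V5 f3 f4 f0 f2 f1) (V5 f4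
      f2 f3 f1 f0), idp,
   [:: (f0, f1); (f1, f0); (f0, f4); (f4, f0); (f1, f4); (f4, f1); (f0, f2);
       (f2, f1); (f1, f2)]);
  (V5 idp (V5 f1 f0 f2 f4 f3) (V5 f2 f3 f4 f0 f1) (V5 f3 f4 f0 f2 f1) (V5 f4
      f3 f1 f0 f2), idp,
   [:: (f0, f1); (f1, f0); (f0, f4); (f4, f1); (f4, f0); (f1, f4); (f0, f3);
       (f3, f4); (f1, f3)]);
  (V5 idp (V5 f1 f0 f2 f4 f3) (V5 f2 f3 f4 f1 f0) (V5 f3 f4 f0 f2 f1) (V5 f4
      f2 f3 f0 f1), idp,
   [:: (f0, f1); (f1, f0); (f1, f2); (f2, f1); (f0, f2); (f2, f0); (f1, f4);
       (f4, f0); (f0, f4)]);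
  (V5 idp (V5 f1 f0 f2 f4 f3) (V5 f2 f3 f4 f1 f0) (V5 f3 f4 f0 f2 f1) (V5 f4
      f2 f3 f1 f0), idp,
   [:: (f0, f3); (f3, f0); (f0, f1); (f1, f0); (f1, f3); (f3, f1); (f3, f4);
       (f4, f0); (f4, f1)]);
  (V5 idp (V5 f1 f0 f2 f4 f3) (V5 f2 f3 f4 f1 f0) (V5 f3 f4 f0 f2 f1) (V5 f4
      f3 f1 f0 f2), idp,
   [:: (f0, f1); (f1, f0); (f0, f3); (f3, f0); (f1, f3); (f3, f1); (f1, f4);
       (f4, f0); (f0, f4)]);
  (V5 idp (V5 f1 f0 f2 f4 f3) (V5 f2 f3 f4 f1 f0) (V5 f3 f4 f2 f0 f1) (V5 f4
      f2 f3 f1 f0), idp,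
   [:: (f0, f3); (f3, f0); (f3, f4); (f4, f0); (f4, f3); (f0, f4); (f0, f1);
       (f1, f3)]);
  (V5 idp (V5 f1 f0 f3 f4 f2) (V5 f2 f0 f1 f3 f4) (V5 f3 f4 f2 f1 f0) (V5 f4
      f1 f2 f0 f3), idp,
   [:: (f1, f2); (f2, f1); (f3, f4); (f4, f3); (f2, f3); (f3, f2); (f3, f1);
       (f1, f3)]);
  (V5 idp (V5 f1 f0 f3 f4 f2) (V5 f2 f0 f3 f1 f4) (V5 f3 f4 f0 f1 f2) (V5 f4
      f3 f1 f2 f0), idp,
   [:: (f1, f4); (f4, f1); (f1, f3); (f3, f4); (f3, f1); (f4, f3); (f1, f2);
       (f2, f3)]);
  (V5 idp (V5 f1 f0 f3 f4 f2) (V5 f2 f0 f4 f1 f3) (V5 f3 f0 f4 f2 f1) (V5 f4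
      f0 f1 f2 f3), idp,
   [:: (f0, f4); (f4, f0); (f0, f2); (f2, f0); (f4, f2); (f2, f4); (f0, f3);
       (f3, f0)]);
  (V5 idp (V5 f1 f0 f3 f4 f2) (V5 f2 f0 f4 f1 f3) (V5 f3 f0 f4 f2 f1) (V5 f4
      f1 f0 f2 f3), idp,
   [:: (f0, f4); (f4, f0); (f1, f3); (f3, f1); (f0, f3); (f3, f0); (f0,
       f1)])].

Lemma certificates_valid : all valid_certificate start_table.
(* The evaluation is left to the kernel at [Qed], so it runs only once. *)
Proof. by vm_cast_no_check (erefl true). Qed.

Definition differ (N M : vec perm5) : bool :=
  some_in (fun k => some_in (fun i =>
    ~~ eq5 (get (get N k) i) (get (get M k) i)) fives) fives.

Lemma differPn N M : ~~ differ N M -> N = M.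
Proof.
rewrite /differ some_inE -all_predC => /allP NM.
apply: vec_ext => k; apply: vec_ext => i; apply/eqP; move: (NM k (mem_fives k)).
by rewrite /= some_inE -all_predC => /allP/(_ i (mem_fives i)); rewrite /= negbK.
Qed.

Definition all_perms : seq perm5 := Eval vm_compute in perms_in (fun _ _ => true).

Lemma all_perms_inj p : p \in all_perms -> injective (get p).
Proof.
have : all (fun p => all (fun x => eq5 (inv5 p (get p x)) x) fives) all_perms.
  by vm_compute.
move=> /allP h /h/allP pK; apply: (can_inj (g := inv5 p)) => x.
exact/eqP/pK/mem_fives.
Qed.

(* In every table entry the second column sends row 1 to symbol 0; testing this
   first avoids most of the normalizations. *)
Definition tabulated (N : vec perm5) : bool :=
  some_in (fun sg =>
    if eq5 (get (get N (get sg f1)) (inv5 (get N (get sg f0)) (get sg f1))) (get sg f0)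
    then let M := normalize sg f0 N in
      some_in (fun r : certificate => ~~ differ M r.1.1) start_table
    else false) all_perms.

Definition starting_at (k i s : five) : bool := if i is f0 then eq5 s k else true.

(** All normalized quintuples of columns without a transversal lie in the tabulated orbits. The
    first four columns prune the fifth: [fits] discards each entry that completes a partial
    transversal through them. *)
Lemma starts_tabulated :
  all (fun n1 => all (fun n2 => all (fun n3 =>
    let st : state :=
      V5 [:: (f0, idp)] [:: (f1, n1)] [:: (f2, n2)] [:: (f3, n3)] [::] in
    all (fun n4 => tabulated (V5 idp n1 n2 n3 n4))
      (perms_in (fun i s => if starting_at f4 i s
         then fits st [:: f0; f1; f2; f3] f4 f4 i s else false)))
    (perms_in (starting_at f3))) (perms_in (starting_at f2))) (perms_in (starting_at f1)).
Proof. by vm_cast_no_check (erefl true). Qed.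

Lemma no_transversal_tabulated N L : latin5 L -> no_transversal L ->
  (forall k a, L k a k = get (get N k) a) ->
  get N f0 = idp -> (forall k, get (get N k) f0 = k) -> tabulated N.
Proof.
case: N => n0 n1 n2 n3 n4 Ll Lbad Lpi /= n0E row; rewrite n0E in Lpi row *.
have nI k : injective (get (get (V5 idp n1 n2 n3 n4) k)).
  by move=> x y; rewrite -!Lpi; apply: Ll.2.
have start k i : starting_at k i (get (get (V5 idp n1 n2 n3 n4) k) i).
  by case: i => //; apply/eqP/row.
have mem k : get (V5 idp n1 n2 n3 n4) k \in perms_in (starting_at k).
  by apply: mem_perms_in; [apply: nI | apply: start].
have /allP/(_ _ (mem f1))/allP/(_ _ (mem f2))/allP/(_ _ (mem f3))/allP := starts_tabulated.
apply; apply: mem_perms_in => [|i]; first exact: (nI f4).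
rewrite (start f4) -[get n4 i](Lpi f4); apply: fits_sound => //.
by case=> c p; rewrite // inE => /eqP[-> ->] a; rewrite Lpi.
Qed.

Lemma tabulated_rigid N : (forall k, injective (get (get N k))) ->
  (forall k, get (get N k) f0 = k) -> tabulated N -> rigid_columns (fun k => get (get N k)).
Proof.
move=> NI row; rewrite /tabulated some_inE => /hasP[sg /all_perms_inj sgI].
case: ifP => // _; rewrite some_inE => /hasP[[[pi phi] cells] rin /differPn/= E].
apply: (rigid_normalize (r := f0) sgI NI); first by move=> k l; rewrite !row.
rewrite E; exact: valid_certificateP (allP certificates_valid _ rin).
Qed.

Lemma distinct_row_rigid (pi : five -> five -> five) r :
  (forall k, injective (pi k)) -> injective (pi ^~ r) -> rigid_columns pi.
Proof.
move=> piI rowI; pose N := tab (fun k => tab (pi k)).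
have NE k a : get (get N k) a = pi k a by rewrite !get_tab.
have NI k : injective (get (get N k)) by move=> x y; rewrite !NE; apply: piI.
have NrI : injective (fun k => get (get N k) r) by move=> k l; rewrite !NE; apply: rowI.
have idI : injective (get idp) by move=> x y; rewrite !get_tab.
have [phi phiI phiR] : rigid_columns (fun k => get (get N k)); last first.
  exists phi => // L Ll Lbad Lpi; have [k a|kappa kE] := phiR L Ll Lbad _.
    by rewrite NE Lpi.
  by exists kappa => k a b; rewrite kE NE.
apply: (rigid_normalize idI NI NrI); set M := normalize idp r N.
have [tM | ntM] := boolP (tabulated M).
  by apply: tabulated_rigid tM => k; [apply: normalize_inj | apply: normalize_row].
(* Outside the table no family without transversal has these columns, so rigidity is vacuous and any
   labelling serves. *)
exists id => // L Ll Lbad Lpi; case/negP: ntM.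
apply: no_transversal_tabulated Ll Lbad Lpi _ _; first exact: normalize_id.
exact: normalize_row.
Qed.

(** * Transversals of latin cubes *)

Section Cube.
Variable q : nat.

Definition update n (x : cell n q) (i : 'I_n) (v : 'I_q) : cell n q :=
  [ffun j => if j == i then v else x j].

Definition extend n (a : 'I_q) (y : cell n q) : cell n.+1 q :=
  [ffun i => if unlift ord0 i is Some j then y j else a].

Lemma extend0 n a (y : cell n q) : extend a y ord0 = a.
Proof. by rewrite ffunE unlift_none. Qed.

Lemma extendS n a (y : cell n q) j : extend a y (lift ord0 j) = y j.
Proof. by rewrite ffunE liftK. Qed.

Lemma update_id n (x : cell n q) i : update x i (x i) = x.
Proof. by apply/ffunP=> j; rewrite ffunE; case: eqP => [->|]. Qed.

Lemma update_extend0 n a b (y : cell n q) : update (extend a y) ord0 b = extend b y.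
Proof.
apply/ffunP=> j; case: (unliftP ord0 j) => [i|] ->; last by rewrite ffunE eqxx extend0.
by rewrite ffunE eq_sym (negPf (neq_lift _ _)) !extendS.
Qed.

Lemma update_extendS n a (y : cell n q) j v :
  update (extend a y) (lift ord0 j) v = extend a (update y j v).
Proof.
apply/ffunP=> l; case: (unliftP ord0 l) => [i|] ->; rewrite ffunE; last first.
  by rewrite (negPf (neq_lift _ _)) !extend0.
by rewrite (inj_eq (@lift_inj _ _)) !extendS ffunE.
Qed.

Definition line_injective n (C : cell n q -> 'I_q) : Prop :=
  forall i x, injective (fun v => C (update x i v)).

(** A line has as many cells as there are symbols, so a surjective line is injective. The injective
    form passes directly to hyperplanes and faces. *)
Lemma latin_line_injective n (C : cell n q -> 'I_q) : latin_cube C -> line_injective C.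
Proof.
move=> hC i x; have surj s : exists v, C (update x i v) = s.
  have [y yl Cy] := hC i x s; exists (y i); rewrite -Cy; congr C.
  apply/ffunP=> j; rewrite ffunE; case: eqP => [-> // | /eqP ji].
  by move: yl; rewrite inE => /forallP/(_ j); rewrite ji => /eqP.
have [g gK] := fin_all_exists surj.
exact: can_inj (canF_sym gK).
Qed.

Definition transversal_family n (C : cell n q -> 'I_q) (x : five -> cell n q) : Prop :=
  (forall i, injective (fun k => x k i)) /\ injective (fun k => C (x k)).
End Cube.

Lemma family_transversal n (C : cell n 5 -> 'I_5) x :
  transversal_family C x -> exists T, cube_transversal C T.
Proof.
move=> [xI CI]; have x_inj : injective x by move=> k l e; apply: CI; rewrite /= e.
exists [set x k | k : five]; split=> [|i a|].
- by rewrite card_imset // -(card_ord 5) (bij_eq_card (Bijective ord_of_fiveK five_of_ordK)).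
- apply/card_le1_eqP=> _ _ /setIP[/imsetP[k _ ->]] + /setIP[/imsetP[l _ ->]].
  by rewrite !inE => /eqP ka /eqP la; congr x; apply: (xI i); rewrite ka la.
- by move=> _ _ /imsetP[k _ ->] /imsetP[l _ ->] /CI ->.
Qed.

(** * The induction step *)

Section Step.
Variables (n : nat) (C : cell n.+1 5 -> 'I_5).
Hypothesis Cline : line_injective C.
Hypothesis Cbad : forall x, ~ transversal_family C x.

Definition column (y : cell n 5) (a : five) : five :=
  five_of_ord (C (extend (ord_of_five a) y)).

Lemma column_inj y : injective (column y).
Proof.
move=> a b /(can_inj five_of_ordK) ab; apply: (can_inj ord_of_fiveK).
by apply: (@Cline ord0 (extend (ord_of_five a) y)); rewrite /= !update_extend0.
Qed.

(* A transversal of the hyperplane where the first coordinate is [r]. *)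
Definition seed (r : five) (y : five -> cell n 5) : Prop :=
  (forall j, injective (fun k => y k j)) /\ injective (fun k => column (y k) r).

(** Column [b] uses the [j]-th coordinate of [y b], so columns and layers share their index and
    column [k] of layer [k] is the column through [y k] itself. *)
Definition face (y : five -> cell n 5) (j : 'I_n) (k a b : five) : five :=
  column (update (y k) j (y b j)) a.

Lemma face_latin r y : seed r y -> forall j, latin5 (face y j).
Proof.
move=> [yI _] j; split=> [k a b b' | k b]; last exact: column_inj.
move=> /(can_inj five_of_ordK) bb'; apply: (yI j).
apply: (@Cline (lift ord0 j) (extend (ord_of_five a) (y k))).
by rewrite /= !update_extendS.
Qed.

(** A transversal of the faces is one of the cube: [alpha] and [beta] separate the first coordinate
    and coordinate [j], and the [y k] already differ in all others. *)
Lemma face_no_transversal r y : seed r y -> forall j, no_transversal (face y j).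
Proof.
move=> [yI _] j alpha beta aI bI sI.
apply: (@Cbad (fun k => extend (ord_of_five (alpha k)) (update (y k) j (y (beta k) j)))).
split=> [i k l | k l]; last by move=> e; apply: sI; rewrite /face /column e.
case: (unliftP ord0 i) => [i'|] ->; last first.
  by rewrite !extend0 => /(can_inj ord_of_fiveK)/aI.
rewrite !extendS !ffunE; case: eqP => _; last exact: yI.
by move=> /yI/bI.
Qed.

Lemma face_diag y j k a : face y j k a k = column (y k) a.
Proof. by rewrite /face update_id. Qed.

Lemma seed_rigid r y : seed r y ->
  exists2 phi, injective phi & rigid phi (fun k => column (y k)).
Proof.
by move=> [_ rI]; apply: (distinct_row_rigid (r := r)) => // k; apply: column_inj.
Qed.

(* Translating coordinate [j] of all the points by the same amount moves the
   point [y f0] to any prescribed [j]-coordinate. *)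
Lemma seed_move r y phi j v : injective phi -> seed r y ->
    rigid phi (fun k => column (y k)) ->
  exists y' t, [/\ seed r y',
    forall k a, phi (column (y' k) a) = (phi (column (y k) a) + t)%R,
    y' f0 j = v & forall i, i != j -> y' f0 i = y f0 i].
Proof.
move=> phiI ys phiR; have [yI rI] := ys.
have [kappa kE] := phiR _ (face_latin ys j) (@face_no_transversal _ _ ys j) (face_diag y j).
have kI : injective kappa.
  move=> b c bc; apply: ((face_latin ys j).1 f0 f0); apply: phiI.
  by rewrite (kE f0 f0 b) (kE f0 f0 c) bc.
have [ki kK kiK] := inj5_bij kI.
have [l0 vE] : exists l, y l j = v.
  have [g fK gK] : exists2 g, cancel (fun k => five_of_ord (y k j)) g &
      cancel g (fun k => five_of_ord (y k j)).
    by apply: inj5_bij => k l /(can_inj five_of_ordK)/yI.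
  by exists (g (five_of_ord v)); apply: (can_inj five_of_ordK); rewrite gK.
(* Column [l k] differs from column [k] by the translation [t], and [l f0 = l0]. *)
pose t := (kappa l0 - kappa f0)%R; pose l k := ki (kappa k + t)%R.
have lI : injective l by move=> k k' /(can_inj kiK)/GRing.addIr/kI.
pose y' k := update (y k) j (y (l k) j).
have E k a : phi (column (y' k) a) = (phi (column (y k) a) + t)%R.
  by have := kE k a (l k); rewrite kiK [(_ + t)%R]GRing.addrC GRing.addrK.
exists y', t; split=> //.
- split=> [i k k' | k k' kk'].
    by rewrite !ffunE; case: eqP => _; [move=> /yI/lI | apply: yI].
  by apply: rI; apply: phiI; apply: (@GRing.addIr _ t); rewrite -(E k) -(E k') kk'.
- by rewrite ffunE eqxx -vE; congr (y _ j); rewrite /l /t GRing.addrC GRing.subrK kK.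
- by move=> i ij; rewrite ffunE (negPf ij).
Qed.

(** Moves [y f0] onto [z] one coordinate at a time, adding up the translations. *)
Lemma seed_transport r y phi (z : cell n 5) : injective phi -> seed r y ->
    rigid phi (fun k => column (y k)) ->
  exists t, forall a, phi (column z a) = (phi (column (y f0) a) + t)%R.
Proof.
move=> phiI ys phiR.
have [y' [t [_ E yz]]] : exists y' t, [/\ seed r y',
    forall k a, phi (column (y' k) a) = (phi (column (y k) a) + t)%R &
    {in enum 'I_n, forall j, y' f0 j = z j}].
  elim: (enum 'I_n) => [|j s [y1 [t1 [ys1 E1 yz1]]]].
    by exists y, 0%R; split=> // k a; rewrite GRing.addr0.
  have [y2 [t2 [ys2 E2 y2j y2i]]] := seed_move j (z j) phiI ys1 (rigid_shift phiI phiR E1).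
  exists y2, (t1 + t2)%R; split=> // [k a | i]; first by rewrite (E2 k) (E1 k) GRing.addrA.
  rewrite inE; have [-> // | ij] := eqVneq i j; by move=> /yz1 <-; apply: y2i.
exists t => a; rewrite -E; congr (phi (column _ a)).
by apply/ffunP=> j; rewrite yz ?mem_enum.
Qed.

Lemma seed_absurd r y : ~ seed r y.
Proof.
move=> ys; have [phi phiI phiR] := seed_rigid ys.
have [t tE] := fin_all_exists (fun k => seed_transport (y k) phiI ys phiR).
have tI : injective t.
  by move=> k l kl; apply: ys.2; apply: phiI; rewrite (tE k) (tE l) kl.
have fI : injective (phi \o column (y f0)) by apply: inj_comp phiI (@column_inj _).
have [g fK gK] := inj5_bij fI.
(* At row [g (t k)] the column through [y f0] has label [t k], so the one through [y k] has label
   [t k + t k]. *)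
apply: (@Cbad (fun k => extend (ord_of_five (g (t k))) (y k))); split=> [i k l|k l].
  case: (unliftP ord0 i) => [j|] ->; first by rewrite !extendS; apply: ys.1.
  by rewrite !extend0 => /(can_inj ord_of_fiveK)/(can_inj gK)/tI.
have E m : phi (five_of_ord (C (extend (ord_of_five (g (t m))) (y m)))) = (t m + t m)%R.
  by rewrite -/(column _ _) (tE m) -[phi (column (y f0) _)]/((phi \o column (y f0)) _) gK.
by move=> /= kl; apply: tI; apply: double5_inj; rewrite -!E kl.
Qed.
End Step.

Lemma line_injective_transversal n (C : cell n.+1 5 -> 'I_5) :
  line_injective C -> exists x, transversal_family C x.
Proof.
elim: n C => [|n IH] C Cline.
  (* In dimension 1 the cube is a single line, and all its cells form a transversal. *)
  exists (fun k => [ffun=> ord_of_five k]); split=> [i k l | k l kl].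
    by rewrite !ffunE => /(can_inj ord_of_fiveK).
  apply: (can_inj ord_of_fiveK); apply: (@Cline ord0 [ffun=> ord0]).
  by move: kl => /=; congr (C _ = C _); apply/ffunP=> j; rewrite !ffunE (ord1 j) eqxx.
(* Finiteness makes the existence of a transversal decidable, which allows arguing by
   contradiction. *)
have [/existsP[x /andP[/forallP xI /injectiveP CI]] | /existsPn none] := boolP
  [exists x : {ffun five -> cell n.+2 5},
    [forall i, injectiveb (fun k => x k i)] && injectiveb (fun k => C (x k))].
  by exists x; split=> // i; apply/injectiveP/xI.
pose r := ord_of_five f0.
have [y [yI CI]] : exists y, transversal_family (fun y => C (extend r y)) y.
  by apply: IH => i y v w; rewrite -!update_extendS; apply: Cline.
have bad x : ~ transversal_family C x.
  move=> [xI xCI]; case/negP: (none [ffun k => x k]); apply/andP; split.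
    by apply/forallP=> i; apply/injectiveP=> k l; rewrite !ffunE; apply: xI.
  by apply/injectiveP=> k l; rewrite !ffunE; apply: xCI.
case: (seed_absurd Cline bad (r := f0) (y := y)); split=> // k l.
by move=> /(can_inj five_of_ordK)/CI.
Qed.

Theorem theorem2 (n : nat) (hn : 2 <= n) (C : cell n 5 -> 'I_5)
    (hC : latin_cube C) :
  exists T : {set cell n 5}, cube_transversal C T.
Proof.
case: n hn C hC => // n _ C hC.
have [x xT] := line_injective_transversal (latin_line_injective hC).
exact: family_transversal xT.
Qed.
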